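(* The inequalities $w\ge\sum_{i=1}^n\eta^{\delta}_{\delta_i}x_{\delta_i}$ for $\delta\in\Delta$, along with the trivial inequalities $\sum_{i\in N_k}x_i\le 1$ for $k\in[t]$ and $0\le x_i\le 1$ for $i\in[n]$, provide a complete linear description of $\operatorname{conv}(X_0)$; that is, $$\operatorname{conv}(X_0)=\Big\{(w,x)\in\mathbb{R}\times\mathbb{R}^n:\ w\ge\sum_{i=1}^n\eta^{\delta}_{\delta_i}x_{\delta_i}\ \forall\delta\in\Delta,\ \ \sum_{i\in N_k}x_i\le1\ \forall k\in[t],\ \ 0\le x_i\le1\ \forall i\in[n]\Big\}.$$
   Context: For a non-negative integer $m$, $[m]=\{1,\dots,m\}$ with $[0]=\varnothing$. Let $n,t$ be positive integers, $f:\mathbb{R}\to\mathbb{R}$ a concave function with $f(0)=0$, $a\in\mathbb{R}^n$ with non-negative entries, and $\{N_k\}_{k\in[t]}$ a partition of $[n]$ into consecutive blocks: with $i_0:=0$ and $i_k:=\sum_{j=1}^k|N_j|$, $N_k=\{i_{k-1}+1,\dots,i_k\}$. Within each block the entries of $a$ are ascending: $a_{i_{k-1}+1}\le\cdots\le a_{i_k}$ for all $k\in[t]$. For $S\subseteq[n]$, $a(S):=\sum_{i\in S}a_i$. Define $$X_0=\Big\{(w,x)\in\mathbb{R}\times\{0,1\}^n:\ w\ge f(a^\top x),\ \sum_{i\in N_k}x_i\le1\ \forall k\in[t]\Big\}.$$ For a permutation $\delta=(\delta_1,\dots,\delta_n)$ of $[n]$, let $\delta(j):=\{\delta_1,\dots,\delta_j\}$.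 The lifting coefficients are defined recursively for $j=1,\dots,n$ by $$\eta^{\delta}_{\delta_j}:=\min_{S}\Big\{ f(a(S))-\sum_{i\in S\setminus\{\delta_j\}}\eta^{\delta}_i \;:\; S\subseteq\delta(j),\ |S\cap N_k|\le 1\ \ \forall k\in[t],\ \delta_j\in S\Big\}.$$ A permutation $\delta$ of $[n]$ is called partial ascending if for all $i,j\in[n]$ and $k\in[t]$ with $i<j$ and $\delta_i,\delta_j\in N_k$, one has $\delta_i<\delta_j$. $\Delta$ denotes the set of all partial ascending permutations of $[n]$. *)

(* Defs.v *)
From mathcomp Require Import all_boot all_order all_algebra.
From mathcomp Require Import fingroup perm.
From mathcomp Require Import all_classical all_reals interval_inference convex.
Set Implicit Arguments.
Unset Strict Implicit.
Unset Printing Implicit Defensive.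
Import Order.TTheory GRing.Theory Num.Theory.
Local Open Scope ring_scope.

(* The index sets [n] and [t] are 'I_n and 'I_t, so every index is shifted down
   by one: the informal element p + 1 of [n] is p : 'I_n, and the informal
   block N_(k+1) is N k. *)

Section Blocks.
Variables n t : nat.
Implicit Types (N : 'I_t -> {set 'I_n}) (S : {set 'I_n}) (delta : 'S_n).

(* i_m = |N_1| + ... + |N_m| *)
Definition block_end N (m : nat) : nat := (\sum_(l < t | (l < m)%N) #|N l|)%N.

(* Injectivity turns the partition formed by the range of N into an indexed
   one; finset's partition requires the blocks to be nonempty. *)
Definition consecutive_partition N : Prop :=
  [/\ finset.partition [set N k | k : 'I_t]%SET [set: 'I_n]%SET,
      injective N
    & forall k (p : 'I_n),
        (p \in N k) = (block_end N k <= p < block_end N k.+1)%N].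

Definition gub_feasible N S : bool := [forall k, (#|S :&: N k| <= 1)%N].

Definition partial_ascending N delta : Prop :=
  forall (i j : 'I_n) (k : 'I_t),
    (i < j)%N -> delta i \in N k -> delta j \in N k -> (delta i < delta j)%N.

(* delta(j) *)
Definition prefix_set delta (j : 'I_n) : {set 'I_n} :=
  [set delta i | i : 'I_n & (i <= j)%N]%SET.

End Blocks.

Section Lifting.
Variables (R : realType) (n t : nat).
Variables (f : R -> R) (a : 'cV[R]_n) (N : 'I_t -> {set 'I_n}).

Definition weight (S : {set 'I_n}) : R := \sum_(i in S) a i 0.

Definition ascending_in_blocks : Prop :=
  forall (k : 'I_t) (i j : 'I_n),
    i \in N k -> j \in N k -> (i <= j)%N -> a i 0 <= a j 0.

Definition lift_feasible (delta : 'S_n) (j : 'I_n) (S : {set 'I_n}) : bool :=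
  [&& S \subset prefix_set delta j, gub_feasible N S & delta j \in S].

Definition lift_value (delta : 'S_n) (eta : 'I_n -> R) (j : 'I_n)
    (S : {set 'I_n}) : R :=
  f (weight S) - \sum_(i in S :\ delta j) eta i.

(* The set [set delta j] is always feasible, so seeding the iterated minimum
   with its value does not change the minimum; see lifting_coefP. *)
Definition lift_min (delta : 'S_n) (eta : 'I_n -> R) (j : 'I_n) : R :=
  \big[Num.min/lift_value delta eta j [set delta j]%SET]_(S : {set 'I_n}
     | lift_feasible delta j S) lift_value delta eta j S.

(* Coefficients of delta_1, ..., delta_m, extended by 0. *)
Fixpoint lifting_upto (delta : 'S_n) (m : nat) : 'I_n -> R :=
  if m is m'.+1 then
    fun i => let j := (delta^-1)%g i in
      if (j : nat) == m' then lift_min delta (lifting_upto delta m') j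
      else lifting_upto delta m' i
  else fun=> 0.

(* The coefficient eta^delta_i. *)
Definition lifting_coef (delta : 'S_n) : 'I_n -> R := lifting_upto delta n.

Lemma mem_prefix_set (delta : 'S_n) (j i : 'I_n) :
  (delta i \in prefix_set delta j) = (i <= j)%N.
Proof.
apply/imsetP/idP => [[i' + /perm_inj->]|ij]; first by rewrite inE.
by exists i => //; rewrite inE.
Qed.

Lemma lift_feasible1 (delta : 'S_n) (j : 'I_n) :
  lift_feasible delta j [set delta j]%SET.
Proof.
rewrite /lift_feasible finset.sub1set mem_prefix_set leqnn finset.set11 andbT /=.
by apply/forallP => k; rewrite (leq_trans (subset_leq_card (finset.subsetIl _ _)))// cards1.
Qed.

Lemma lifting_upto_stable (delta : 'S_n) (m1 m2 : nat) (i : 'I_n) :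
  (i < m1)%N -> (m1 <= m2)%N ->
  lifting_upto delta m2 (delta i) = lifting_upto delta m1 (delta i).
Proof.
move=> im1; elim: m2 => [|m2 IH]; first by rewrite leqn0 => /eqP ->.
rewrite leq_eqVlt => /predU1P[->//|]; rewrite ltnS => m12 /=.
by rewrite permK ltn_eqF ?IH// (leq_trans im1).
Qed.

Lemma lifting_coefE (delta : 'S_n) (j : 'I_n) :
  lifting_coef delta (delta j) = lift_min delta (lifting_coef delta) j.
Proof.
rewrite /lifting_coef (@lifting_upto_stable delta j.+1 n j)//= permK eqxx.
have eqv S : lift_feasible delta j S ->
    lift_value delta (lifting_upto delta j) j S =
    lift_value delta (lifting_upto delta n) j S.
  case/and3P=> /fintype.subsetP sub _ _; congr (_ - _); apply: eq_bigr => i.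
  rewrite !inE => /andP[ij /sub]; rewrite -[i](permKV delta) in ij *.
  rewrite mem_prefix_set leq_eqVlt => /predU1P[/val_inj e|lt].
    by rewrite e eqxx in ij.
  by rewrite (@lifting_upto_stable delta j n)// ltnW.
by rewrite /lift_min (eqv _ (lift_feasible1 _ _)); apply: eq_bigr.
Qed.

Lemma lifting_coefP (delta : 'S_n) (j : 'I_n) :
  let F := lift_value delta (lifting_coef delta) j in
  (exists2 S, lift_feasible delta j S & lifting_coef delta (delta j) = F S) /\
  (forall S, lift_feasible delta j S -> lifting_coef delta (delta j) <= F S).
Proof.
move=> F; rewrite lifting_coefE; split; last first.
  by move=> S SF; rewrite /lift_min (bigD1 S)//= ge_min lexx.
rewrite /lift_min.
apply: (big_ind (fun z => exists2 S, lift_feasible delta j S & z = F S))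
  => [|x y [S SF ->] [T TF ->]|S SF].
- by exists [set delta j]%SET; first exact: lift_feasible1.
- by case: (leP (F S) (F T)) => _; [exists S|exists T].
- by exists S.
Qed.

End Lifting.

Local Open Scope classical_set_scope.
Local Open Scope convex_scope.

Definition concave_function (R : realType) (f : R -> R) : Prop :=
  forall (s : {i01 R}) (x y : R^o),
    ((f x : R^o) <| s |> (f y : R^o) <= f (x <| s |> y))%R.

Definition conv_hull (R : realType) (E : lmodType R) (A : set E) : set E :=
  smallest (@convex_set R E) A.

Definition X0 (R : realType) (n t : nat) (f : R -> R) (a : 'cV[R]_n)
    (N : 'I_t -> {set 'I_n}) : set (R^o * 'cV[R]_n) :=
  [set p : R^o * 'cV[R]_n | let: (w, x) := p in
     [/\ forall i, x i 0 = 0 \/ x i 0 = 1,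
         f ((a^T *m x) 0 0) <= w
       & forall k, \sum_(i in N k) x i 0 <= 1]].

(* Main.v *)
(* Let b be the increments of a inside the blocks, so that b >= 0 and the weight
   of a feasible S is b(D), where D is the union of the initial block segments
   ending at the elements of S.  Concavity makes D |-> f(b(D)) submodular, hence
   the greedy vector m of marginals of f(b(-)) along delta satisfies
   m(D) <= f(b(D)), with equality on every prefix of delta.  For partial ascending
   delta every prefix is such a union D, generated by its block maxima; so the
   lifting coefficient of i is the sum of m over the block segment ending at i,
   and the lifted inequality is valid, and tight at the block maxima of each
   prefix.
   Given a point (w, x) satisfying the inequalities, let y_i be the sum of x over
   the block segment starting at i.  Sorting y decreasingly, ties broken by index,
   gives a partial ascending delta, and the consecutive differences of the sorted
   y are the weights of a convex combination of the sets of block maxima of the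
   prefixes of delta that equals x. *)
Require Import Defs.
From mathcomp Require Import all_boot all_order all_algebra.
From mathcomp Require Import fingroup perm.
From mathcomp Require Import all_classical all_reals interval_inference convex.
From mathcomp Require Import zify ring lra.
Local Open Scope classical_set_scope.
Local Open Scope ring_scope.

Set Implicit Arguments.
Unset Strict Implicit.
Unset Printing Implicit Defensive.
Import Order.TTheory GRing.Theory Num.Theory.

(** * Concave increments, finite convex combinations, sorting *)

Lemma concave_function_incr (R : realType) (f : R -> R) (u v d : R) :
  concave_function f -> u <= v -> 0 <= d -> f (v + d) - f v <= f (u + d) - f u.
Proof.
move=> cf uv d0.
have [L0|Lneq0] := eqVneq (v + d - u) 0.
  have d00 : d = 0 by lra.
  by rewrite d00 !addr0 !subrr.
have L0 : 0 < v + d - u by rewrite lt_neqAle eq_sym Lneq0; lra.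
(* Both [v] and [u + d] lie between [u] and [v + d], with the weights [s] and [1 - s] exchanged;
   adding the two concavity inequalities gives the claim. *)
have s01 : 0 <= (v - u) / (v + d - u) <= 1.
  by rewrite ler_pdivlMr// ler_pdivrMr//; lra.
set s := (v - u) / (v + d - u) in s01.
have sE : s * (v + d - u) = v - u by rewrite divfK.
have s'01 : 0 <= 1 - s <= 1 by lra.
have h1 := cf (Itv01 (proj1 (andP s01)) (proj2 (andP s01))) (v + d) u.
have h2 := cf (Itv01 (proj1 (andP s01)) (proj2 (andP s01))) u (v + d).
rewrite !convRE /= /unstable.onem in h1 h2.
have e1 : s * (v + d) + (1 - s) * u = v by lra.
have e2 : s * u + (1 - s) * (v + d) = u + d by lra.
rewrite {}e1 in h1; rewrite {}e2 in h2.
lra.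
Qed.

Lemma convex_set_sum (R : realType) (E : lmodType R) (A : set E)
    (I : finType) (l : I -> R) (p : I -> E) :
  @convex_set R E A -> (forall i, 0 <= l i) -> \sum_i l i = 1 ->
  (forall i, A (p i)) -> A (\sum_i l i *: p i).
Proof.
move=> cA l0 l1 pA.
(* Convexity is binary, so partial sums are renormalised by their total weight for the induction. *)
suff H (s : seq I) : 0 < \sum_(i <- s) l i ->
    A ((\sum_(i <- s) l i)^-1 *: \sum_(i <- s) l i *: p i).
  by have := H (index_enum I); rewrite l1 invr1 scale1r; apply; rewrite ltr01.
elim: s => [|i s IH]; first by rewrite big_nil ltxx.
rewrite !big_cons; set L := \sum_(j <- s) l j; set v := \sum_(j <- s) _ => lL.
have L0 : 0 <= L by rewrite sumr_ge0.
have [Lz|Lnz] := eqVneq L 0.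
  have -> : v = 0.
    move: Lz => /eqP; rewrite psumr_eq0// => /allP z.
    by rewrite /v big_seq big1// => j /z /eqP ->; rewrite scale0r.
  rewrite Lz !addr0 scalerA mulVf ?scale1r//.
  by move: lL; rewrite Lz addr0 => /lt0r_neq0.
have L0' : 0 < L by rewrite lt_neqAle eq_sym Lnz.
have t01 : 0 <= l i / (l i + L) <= 1.
  by rewrite ler_pdivlMr// ler_pdivrMr// mul0r mul1r l0 lerDl.
have := cA (p i) (L^-1 *: v) (Itv01 (proj1 (andP t01)) (proj2 (andP t01))).
rewrite !inE => /(_ (pA i) (IH L0')).
suff -> : conv (Itv01 (proj1 (andP t01)) (proj2 (andP t01)))
   (p i : convex_lmodType E) (L^-1 *: v) = (l i + L)^-1 *: (l i *: p i + v) by [].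
rewrite /conv /= /unstable.onem scalerDr !scalerA; congr (_ *: _ + _ *: _).
  by rewrite mulrC.
have lLn := lt0r_neq0 lL.
by field; rewrite Lnz lLn.
Qed.

(** Ties are broken by index so that equal values within a block still come in ascending order. The
    sort uses a reflexive total order; strictness comes back from injectivity of [delta]. *)
Lemma exists_sorting_perm (R : realDomainType) (n : nat) (y : 'I_n -> R) :
  exists delta : 'S_n, forall i j : 'I_n, (i < j)%N ->
    (y (delta j) < y (delta i)) ||
    (y (delta j) == y (delta i)) && (delta i < delta j)%N.
Proof.
pose r (p q : 'I_n) := (y q < y p) || (y q == y p) && (p <= q)%N.
have rtr : transitive r.
  move=> q p s /orP[h1|/andP[/eqP h1 k1]] /orP[h2|/andP[/eqP h2 k2]]; rewrite /r.
  - by rewrite (lt_trans h2 h1).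
  - by rewrite h2 h1.
  - by rewrite -h1 h2.
  - by rewrite h2 h1 eqxx (leq_trans k1 k2) orbT.
have rtot : total r.
  by move=> p q; rewrite /r; case: (ltgtP (y p) (y q)) => //= _; exact: leq_total.
have pe : perm_eq (sort r (enum 'I_n)) (ord_tuple n) by rewrite perm_sort val_ord_tuple.
have [delta sE] := tuple_permP pe.
exists delta => i j ij.
have ss := sort_sorted rtot (enum 'I_n).
have := sorted_ltn_nth rtr i ss.
have sz : size (sort r (enum 'I_n)) = n by rewrite size_sort size_enum_ord.
move=> /(_ i j); rewrite !inE sz !ltn_ord => /(_ isT isT ij).
rewrite sE -!tnth_nth !tnth_mktuple !tnth_ord_tuple /r.
case/orP => [->//|/andP[-> le]]; rewrite ltn_neqAle le andbT orbC.
suff -> : (delta i : nat) != delta j by [].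
by apply: contraTneq ij => /val_inj /perm_inj ->; rewrite ltnn.
Qed.

(** * The greedy vector of a concave function of a modular weight *)

Section Greedy.
Variables (R : realType) (n : nat) (f : R -> R) (b : 'I_n -> R) (delta : 'S_n).

(** Here [j] is a length, so [j = 0] gives the empty prefix, whereas [prefix_set delta j] includes
    position [j]. *)
Definition first_elems (j : nat) : {set 'I_n} :=
  [set i | ((delta^-1)%g i < j)%N]%SET.

Definition greedy_coef (i : 'I_n) : R :=
  let j : 'I_n := (delta^-1)%g i in
  f (\sum_(p in first_elems j.+1) b p) - f (\sum_(p in first_elems j) b p).

Lemma first_elems0 : first_elems 0 = finset.set0.
Proof. by apply/setP => i; rewrite !inE. Qed.

Lemma first_elemsS (j : 'I_n) :
  first_elems j.+1 = (delta j |: first_elems j)%SET.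
Proof.
apply/setP => i; rewrite !inE ltnS leq_eqVlt; congr (_ || _).
by rewrite -[in RHS](inj_eq (@perm_inj _ (delta^-1)%g)) permK.
Qed.

Lemma notin_first_elems (j : 'I_n) : delta j \notin first_elems j.
Proof. by rewrite inE permK ltnn. Qed.

Lemma first_elemsT : first_elems n = [set: 'I_n]%SET.
Proof. by apply/setP => i; rewrite !inE ltn_ord. Qed.

Lemma prefix_setE (j : 'I_n) : prefix_set delta j = first_elems j.+1.
Proof.
apply/setP => i; rewrite -[i](permKV delta) mem_prefix_set inE permKV.
by rewrite ltnS.
Qed.

Lemma greedy_coef_perm (j : 'I_n) :
  greedy_coef (delta j) =
  f (\sum_(p in first_elems j.+1) b p) - f (\sum_(p in first_elems j) b p).
Proof. by rewrite /greedy_coef permK. Qed.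

Lemma sum_greedy_first_elems (j : nat) :
  f 0 = 0 -> (j <= n)%N ->
  \sum_(i in first_elems j) greedy_coef i = f (\sum_(i in first_elems j) b i).
Proof.
move=> f0; elim: j => [|j IH] jn; first by rewrite first_elems0 !big_set0 f0.
pose k := Ordinal jn.
have kn := notin_first_elems k.
have := first_elemsS k; rewrite /= => E.
rewrite E big_setU1//= IH 1?ltnW// greedy_coef_perm /= E.
by rewrite subrK.
Qed.

(** Induction along the prefixes: adding [delta k] to the part of the prefix inside [D] raises [f]
    of the weight at least as much as adding it to the whole prefix, which is heavier. *)
Lemma sum_greedy_le (D : {set 'I_n}) :
  concave_function f -> f 0 = 0 -> (forall i, 0 <= b i) ->
  \sum_(i in D) greedy_coef i <= f (\sum_(i in D) b i).
Proof.
move=> cf f0 b0.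
suff H j : (j <= n)%N -> \sum_(i in D :&: first_elems j) greedy_coef i
    <= f (\sum_(i in D :&: first_elems j) b i).
  by have := H n (leqnn n); rewrite first_elemsT finset.setIT.
elim: j => [|j IH] jn; first by rewrite first_elems0 finset.setI0 !big_set0 f0.
pose k := Ordinal jn.
have kn := notin_first_elems k.
have := first_elemsS k; rewrite /= => E.
have [kD|kD] := boolP (delta k \in D); last first.
  suff -> : (D :&: first_elems j.+1 = D :&: first_elems j)%SET by exact: IH (ltnW jn).
  rewrite E; apply/setP => i; rewrite !inE.
  by case: eqVneq => [->|//]; rewrite (negbTE kD).
have -> : (D :&: first_elems j.+1 = delta k |: (D :&: first_elems j))%SET.
  by rewrite E; apply/setP => i; rewrite !inE; case: eqVneq => [->|//]; rewrite kD.
have kn' : delta k \notin D :&: first_elems j by rewrite inE (negbTE kn) andbF.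
rewrite !big_setU1//= greedy_coef_perm /= E big_setU1//=.
have uv : \sum_(i in D :&: first_elems j) b i <= \sum_(i in first_elems j) b i.
  rewrite [leRHS](big_setID D)/= finset.setIC lerDl; exact: sumr_ge0.
have := concave_function_incr cf uv (b0 (delta k)).
have := IH (ltnW jn).
rewrite [b _ + \sum_(i in first_elems _) _]addrC [b _ + \sum_(i in _ :&: _) _]addrC.
lra.
Qed.

End Greedy.

(** * The order inside blocks, its ideals and their maxima *)

Section Blocks.
Variables (n t : nat) (N : 'I_t -> {set 'I_n}) (c : 'I_n -> 'I_t).
Hypothesis mem_N : forall k i, (i \in N k) = (c i == k).
Implicit Types (S : {set 'I_n}) (i j : 'I_n).

Definition below i j := (i <= j)%N && (c i == c j).

Definition down S : {set 'I_n} := [set i | [exists s in S, below i s]]%SET.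

Lemma gub_feasibleP S :
  reflect {in S &, injective c} (gub_feasible N S).
Proof.
apply: (iffP forallP) => [fS i j iS jS cij|cS k].
  have /card_le1_eqP := fS (c i); apply; rewrite inE mem_N ?iS ?jS ?cij ?eqxx//.
apply/card_le1_eqP => i j; rewrite !inE !mem_N => /andP[iS /eqP ik] /andP[jS /eqP jk].
by apply: cS; rewrite // ik jk.
Qed.

(** A feasible [S] meets the block of [i] at most once, so at most one term is nonzero. *)
Lemma sum_below_down (R : pzRingType) S i : gub_feasible N S ->
  \sum_(s in S) (below i s)%:R = (i \in down S)%:R :> R.
Proof.
move=> /gub_feasibleP fS; rewrite inE.
case: existsP => [[s /andP[sS si]]|nS].
  rewrite (bigD1 s)//= si big1 ?addr0// => s' /andP[s'S ss'].
  case: (boolP (below i s')) => // s'i; case/negP: ss'; apply/eqP/fS => //.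
  by case/andP: si => _ /eqP <-; case/andP: s'i => _ /eqP <-.
by rewrite big1// => s sS; case: (boolP (below i s)) => // si; case: nS; exists s; rewrite sS.
Qed.

Lemma sum_down (R : pzRingType) (F : 'I_n -> R) S : gub_feasible N S ->
  \sum_(s in S) \sum_(i | below i s) F i = \sum_(i in down S) F i.
Proof.
move=> fS.
under eq_bigr do rewrite big_mkcond.
rewrite exchange_big /= [RHS]big_mkcond /=; apply: eq_bigr => i _.
(* The conditional term becomes an indicator times [F i], ready for [sum_below_down]. *)
rewrite -[RHS]mulr1 -[RHS]/(_ * _) (_ : _ * 1 = (i \in down S)%:R * F i); last first.
  by case: (i \in _); rewrite ?mul0r ?mul1r ?mulr1.
rewrite -sum_below_down// mulr_suml; apply: eq_bigr => s _.
by case: below; rewrite ?mul0r ?mul1r.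
Qed.

(** The linear system is unitriangular; it is solved from the largest index downwards. *)
Lemma eq0_sum_above (R : pzRingType) (z : 'I_n -> R) :
  (forall i, \sum_(j | below i j) z j = 0) -> forall i, z i = 0.
Proof.
move=> H i; have [m] := ubnP (n - i); elim: m i => // m IH i im.
have := H i; rewrite (bigD1 i)/= /below ?leqnn ?eqxx// big1 ?addr0//.
move=> j /andP[/andP[ij _] ji]; apply: IH.
have : (i < j)%N by rewrite ltn_neqAle ij andbT eq_sym.
move: im (ltn_ord j); lia.
Qed.

Lemma exists_block_increments (R : numDomainType) (a : 'I_n -> R) :
  (forall i j l : 'I_n, (i <= j <= l)%N -> c i = c l -> c j = c i) ->
  (forall i, 0 <= a i) -> (forall i j, below i j -> a i <= a j) ->
  exists2 b : 'I_n -> R, forall i, 0 <= b i &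
    forall i, \sum_(j | below j i) b j = a i.
Proof.
move=> cconv a0 amon.
(* The sum has at most one term, the predecessor of [i] when it lies in the same block; at the start
   of a block [b i = a i]. *)
pose b i := a i - \sum_(j : 'I_n | (j.+1 == i)%N && (c j == c i)) a j.
have bS i (p : 'I_n) : (p.+1 == i)%N -> c p == c i -> b i = a i - a p.
  move=> pi cpi; rewrite /b (big_pred1 p)// => j /=.
  apply/andP/eqP => [[/eqP ji _]|->//]; apply: val_inj => /=.
  by move: ji (eqP pi); lia.
have b1 i : (forall p : 'I_n, (p.+1 == i)%N -> c p != c i) -> b i = a i.
  move=> np; rewrite /b big_pred0 ?subr0// => j /=.
  by apply/andP => -[ji cji]; have := np j ji; rewrite cji.
exists b => i.
  have [[p /andP[pi cpi]]|np] := altP (@existsP _ (fun p : 'I_n => (p.+1 == i)%N && (c p == c i))).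
    by rewrite (bS i p)// subr_ge0 amon// /below cpi -(eqP pi) leqnSn.
  rewrite b1// => p pi; apply/negP => cpi; case/existsP: np; exists p; exact/andP.
have [m] := ubnP i; elim: m i => // m IH i im.
have [/existsP[p /andP[pi cpi]]|np] := boolP [exists p : 'I_n, (p.+1 == i)%N && (c p == c i)].
  rewrite (bigD1 i)/= /below ?leqnn ?eqxx// (bS i p)//.
  rewrite (eq_bigl (fun j => below j p)) ?IH ?subrK//.
    by move: im; rewrite -(eqP pi).
  move=> j; rewrite /below (eqP cpi) andbAC; congr (_ && _).
  by rewrite andbC -[(j <= p)%N]ltnS (eqP pi) ltn_neqAle.
rewrite (big_pred1 i) => [|j /=].
  rewrite b1// => p pi; apply/negP => cpi; case/existsP: np; exists p; exact/andP.
rewrite /below; apply/andP/eqP => [[ji /eqP cji]|->//].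
(* Since blocks are intervals, a smaller [j] in the block of [i] would put the predecessor of [i]
   there too. *)
apply/eqP; rewrite eqE/=; apply: contraNT np => nji.
have jlti : (j < i)%N by rewrite ltn_neqAle nji.
have pn : (i.-1 < n)%N by rewrite (leq_ltn_trans (leq_pred i)).
apply/existsP; exists (Ordinal pn); rewrite /= (ltn_predK jlti) eqxx /=.
rewrite -cji; apply/eqP/(cconv _ _ i) => //=; rewrite leq_pred andbT.
by move: jlti; lia.
Qed.


Definition block_tops (D : {set 'I_n}) : {set 'I_n} :=
  [set i in D | [forall j in D, below i j ==> (j == i)]]%SET.

Definition block_closed (D : {set 'I_n}) :=
  forall i j, below i j -> j \in D -> i \in D.

Lemma gub_feasible_block_tops D : gub_feasible N (block_tops D).
Proof.
apply/gub_feasibleP => i j; rewrite !inE.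
move=> /andP[iD /forall_inP iT] /andP[jD /forall_inP jT] cij.
have [ij|/ltnW ji] := leqP i j.
  by apply/eqP; rewrite eq_sym (implyP (iT j jD))// /below ij cij/=.
by apply/eqP; rewrite (implyP (jT i iD))// /below ji cij/=.
Qed.

(** Each element of [D] lies below the largest element of [D] in its block, which is a top;
    closedness gives the converse. *)
Lemma down_block_tops D : block_closed D -> down (block_tops D) = D.
Proof.
move=> cD; apply/setP => i; rewrite inE; apply/exists_inP/idP.
  by move=> [s]; rewrite inE => /andP[sD _] /cD; apply.
move=> iD.
have ii : (i \in D) && below i i by rewrite iD /below leqnn eqxx.
have [s /andP[sD si] smax] :=
  @arg_maxnP _ i (fun s => (s \in D) && below i s) (fun s => s) ii.
exists s => //; rewrite inE sD; apply/forall_inP => j jD; apply/implyP.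
move=> /andP[sj csj]; apply/eqP/val_inj/eqP; rewrite eqn_leq sj andbT.
apply: smax; rewrite jD; case/andP: si => lei ci.
by rewrite /below (leq_trans lei sj) (eqP ci).
Qed.

(** * Lifting coefficients of a partial ascending permutation *)

Section PartialAscending.
Variable delta : 'S_n.
Hypothesis PA : partial_ascending N delta.

Lemma partial_ascending_below i j :
  below i j -> ((delta^-1)%g i <= (delta^-1)%g j)%N.
Proof.
move=> /andP[ij cij]; rewrite leqNgt; apply/negP => ji.
have := PA ji (k := c j); rewrite !permKV !mem_N eqxx cij => /(_ isT isT).
by rewrite ltnNge ij.
Qed.

Lemma block_closed_first_elems m : block_closed (first_elems delta m).
Proof.
by move=> i j ij; rewrite !inE; apply: leq_ltn_trans; exact: partial_ascending_below.
Qed.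

(** This set will attain the lifting minimum. It contains [delta j] because larger elements of that
    block come later in [delta]. *)
Lemma lift_feasible_block_tops (j : 'I_n) :
  lift_feasible N delta j (block_tops (first_elems delta j.+1)).
Proof.
rewrite /lift_feasible gub_feasible_block_tops prefix_setE; apply/and3P; split=> //.
  by apply/fintype.subsetP => i; rewrite inE => /andP[].
rewrite !inE permK ltnSn; apply/forall_inP => i; rewrite inE ltnS => ij.
apply/implyP => /partial_ascending_below; rewrite permK => ji.
have /val_inj <- : (delta^-1)%g i = j :> nat by apply/eqP; rewrite eqn_leq ij.
by rewrite permKV.
Qed.

Variables (R : realType) (f : R -> R) (a : 'cV[R]_n) (b : 'I_n -> R).
Hypotheses (cf : concave_function f) (f0 : f 0 = 0) (b0 : forall i, 0 <= b i).
Hypothesis sum_b : forall i, \sum_(j | below j i) b j = a i 0.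

Lemma weight_down S : gub_feasible N S -> weight a S = \sum_(i in down S) b i.
Proof.
by move=> fS; rewrite -sum_down//; apply: eq_bigr => i _; rewrite sum_b.
Qed.

Let z i := \sum_(p | below p i) greedy_coef f b delta p.

Let z_le S : gub_feasible N S -> \sum_(i in S) z i <= f (weight a S).
Proof. by move=> fS; rewrite /z sum_down// weight_down//; exact: sum_greedy_le. Qed.

Let z_tops m : (m <= n)%N -> \sum_(i in block_tops (first_elems delta m)) z i =
  f (weight a (block_tops (first_elems delta m))).
Proof.
move=> mn; have fS := gub_feasible_block_tops (first_elems delta m).
rewrite /z sum_down// weight_down// down_block_tops; last exact: block_closed_first_elems.
exact: sum_greedy_first_elems.
Qed.

(** Induction on the position [j]: once the earlier coefficients equal [z], the lifting objective at
    [S] is [z (delta j)] plus the slack of [S] in [z_le]. That slack is nonnegative, and zero at the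
    block tops of the prefix. *)
Lemma lifting_coef_greedy i :
  lifting_coef f a N delta i = \sum_(p | below p i) greedy_coef f b delta p.
Proof.
rewrite -/(z i) -[i](permKV delta); move: ((delta^-1)%g i) => j.
have [m] := ubnP j; elim: m j => // m IH j jm.
have zE S : lift_feasible N delta j S ->
    lift_value f a delta (lifting_coef f a N delta) j S =
    f (weight a S) - \sum_(i in S) z i + z (delta j).
  case/and3P => /fintype.subsetP sub _ jS.
  rewrite (big_setD1 (delta j) jS)/= /lift_value opprD addrA addrAC subrK.
  congr (_ - _).
  apply: eq_bigr => p; rewrite !inE => /andP[pj /sub].
  rewrite prefix_setE inE ltnS -{2 3}[p](permKV delta) => pj'.
  apply: IH; apply: (leq_trans (n := j)) => //; rewrite ltn_neqAle pj' andbT.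
  by apply: contraNN pj => /eqP /val_inj <-; rewrite permKV.
have [[S FS eS] le] := lifting_coefP f a N delta j.
apply/eqP; rewrite eq_le; apply/andP; split.
  have FT := lift_feasible_block_tops j.
  by have := le _ FT; rewrite (zE _ FT) z_tops// subrr add0r.
by rewrite eS zE// lerDr subr_ge0; apply: z_le; case/and3P: FS.
Qed.

Lemma sum_lifting_coef_le S :
  gub_feasible N S -> \sum_(i in S) lifting_coef f a N delta i <= f (weight a S).
Proof.
by move=> fS; under eq_bigr do rewrite lifting_coef_greedy; exact: z_le.
Qed.

Lemma sum_lifting_coef_block_tops m : (m <= n)%N ->
  \sum_(i in block_tops (first_elems delta m)) lifting_coef f a N delta i =
  f (weight a (block_tops (first_elems delta m))).
Proof.
by move=> mn; under eq_bigr do rewrite lifting_coef_greedy; exact: z_tops.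
Qed.

End PartialAscending.

(** * Decomposition of a point along a chain of prefixes *)

Lemma chain_decomposition (R : realDomainType) (x : 'I_n -> R) :
  (forall i, 0 <= x i) -> (forall k, \sum_(i in N k) x i <= 1) ->
  exists delta : 'S_n, exists2 l : 'I_n.+1 -> R,
    partial_ascending N delta /\ (forall m, 0 <= l m) &
    \sum_m l m = 1 /\ forall i,
      x i = \sum_m l m * (i \in block_tops (first_elems delta m))%:R.
Proof.
move=> x0 x1.
pose y i := \sum_(j | below i j) x j.
have y0 i : 0 <= y i by apply: sumr_ge0.
have y1 i : y i <= 1.
  apply: le_trans (x1 (c i)); rewrite [leRHS](bigID (below i))/=.
  suff -> : y i = \sum_(j in N (c i) | below i j) x j by rewrite lerDl sumr_ge0.
  apply: eq_bigl => j; rewrite mem_N /below eq_sym.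
  by case: (c j == c i); rewrite ?andbF ?andbT.
have ymon i j : below i j -> y j <= y i.
  move=> /andP[ij cij]; rewrite [leRHS](bigID (below j))/=.
  suff -> : y j = \sum_(k | below i k && below j k) x k by rewrite lerDl sumr_ge0.
  apply: eq_bigl => k; rewrite /below (eqP cij).
  case: (c j == c k); rewrite ?andbF ?andbT//.
  by apply/idP/andP => [jk|[]//]; split => //; apply: leq_trans jk.
have [delta ysort] := exists_sorting_perm y.
have PA : partial_ascending N delta.
  move=> i j k ij; rewrite !mem_N => /eqP ci /eqP cj; rewrite ltnNge; apply/negP => ji.
  have := ymon (delta j) (delta i); rewrite /below ji ci cj eqxx => /(_ isT) yle.
  have /orP[|/andP[_]] := ysort _ _ ij; first by rewrite ltNge yle.
  by rewrite ltnNge ji.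
(* [Y] lists 1, then [y] along [delta], then 0. *)
pose Y m := if m is m'.+1 then
  (if insub m' is Some p then y (delta p) else 0) else 1.
have Yn : Y n.+1 = 0 by rewrite /Y insubF ?ltnn.
have YS (j : 'I_n) : Y j.+1 = y (delta j) by rewrite /Y valK.
have Ymon m : (m <= n)%N -> Y m.+1 <= Y m.
  case: m => [|m] mn; first by rewrite /Y; case: insubP.
  rewrite -[X in _ <= Y X.+1]/(nat_of_ord (Ordinal mn)) YS /Y.
  case: insubP => [p _ pm|_]; last exact: y0.
  have /ysort : (Ordinal mn < p)%N by rewrite pm.
  by case/orP => [/ltW//|/andP[/eqP ->]].
have tel p : (p <= n.+1)%N -> \sum_(p <= j < n.+1) (Y j - Y j.+1) = Y p.
  move=> pn; rewrite (telescope_sumr_eq (fun m => - Y m)) => [|//|k _].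
    by rewrite Yn oppr0 add0r opprK.
  by rewrite opprK addrC.
(* Index [j] is the prefix length; [l 0] weights the empty set and completes the total to
   [Y 0 = 1]. *)
pose l (j : 'I_n.+1) := Y j - Y j.+1.
exists delta, l; first by split=> // j; rewrite subr_ge0 Ymon// -ltnS.
split; first by rewrite /l -(big_mkord xpredT (fun m => Y m - Y m.+1)) tel.
(* Only prefixes longer than the position of [i] contain it, so the sum telescopes from there. *)
have yE i : \sum_(j < n.+1) l j * (i \in first_elems delta j)%:R = y i.
  rewrite /l -(big_mkord xpredT
    (fun m => (Y m - Y m.+1) * (i \in first_elems delta m)%:R)).
  have pn := ltn_ord ((delta^-1)%g i).
  rewrite (@big_cat_nat _ _ _ ((delta^-1)%g i).+1)//= 1?ltnW// big_nat big1 ?add0r.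
    have -> : y i = Y ((delta^-1)%g i).+1 by rewrite YS permKV.
    rewrite -[RHS]tel; last by rewrite ltnS ltnW.
    by apply: eq_big_nat => j /andP[ij _]; rewrite inE ij mulr1.
  by move=> j /andP[_ ji]; rewrite inE ltnNge -ltnS ji mulr0.
(* Summed over the block segment starting at [i], both sides give [y i]: the indicator of the tops
   sums to that of the prefix. By [eq0_sum_above] these sums determine the vector. *)
move=> i; apply/eqP; rewrite -subr_eq0; apply/eqP; move: i.
apply: eq0_sum_above => i; rewrite sumrB -/(y i) exchange_big/= -yE.
apply/eqP; rewrite subr_eq0; apply/eqP/eq_bigr => j _; rewrite -mulr_sumr; congr (_ * _).
rewrite -{1}(down_block_tops (@block_closed_first_elems _ PA j)).
rewrite -sum_below_down ?gub_feasible_block_tops// big_mkcond [RHS]big_mkcond.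
by apply: eq_bigr => s _; case: (s \in _); case: below.
Qed.

End Blocks.

(** * Block index map and increments from the hypotheses on [N] and [a] *)

Lemma consecutive_partition_index (n t : nat) (N : 'I_t -> {set 'I_n}) :
  consecutive_partition N ->
  exists2 c : 'I_n -> 'I_t, forall k i, (i \in N k) = (c i == k) &
    forall i j l : 'I_n, (i <= j <= l)%N -> c i = c l -> c j = c i.
Proof.
move=> [Npart Ninj Nitv].
have Nex i : exists k, i \in N k.
  have : i \in finset.cover [set N k | k : 'I_t]%SET by rewrite (finset.cover_partition Npart) inE.
  by case/finset.bigcupP => _ /imsetP[k _ ->] ik; exists k.
have /finset.trivIsetP Ntriv : finset.trivIset [set N k | k : 'I_t]%SET by case/and3P: Npart.
have Nuniq i k l : i \in N k -> i \in N l -> k = l.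
  move=> ik il; apply/eqP; apply: contraT => kl.
  have /(Ntriv _ _ (imset_f _ _) (imset_f _ _)) : N k != N l by rewrite (inj_eq Ninj).
  by move=> /(_ isT isT) /disjoint_setI0 /setP /(_ i); rewrite !inE ik il.
pose c i := xchoose (Nex i).
have ic i : i \in N (c i) := xchooseP (Nex i).
have mem_N k i : (i \in N k) = (c i == k).
  by apply/idP/eqP => [|<-//]; exact: Nuniq.
exists c => // i j l /andP[ij jl] cil; apply/eqP; rewrite -mem_N Nitv.
have := ic i; have := ic l; rewrite -cil !Nitv => /andP[_ lu] /andP[li _].
by rewrite (leq_trans li ij) (leq_ltn_trans jl lu).
Qed.

Lemma exists_lifting_increments (R : realType) (n t : nat) (a : 'cV[R]_n)
    (N : 'I_t -> {set 'I_n}) (c : 'I_n -> 'I_t) :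
  (forall k i, (i \in N k) = (c i == k)) ->
  (forall i j l : 'I_n, (i <= j <= l)%N -> c i = c l -> c j = c i) ->
  (forall i, 0 <= a i 0) -> ascending_in_blocks a N ->
  exists2 b : 'I_n -> R, forall i, 0 <= b i &
    forall i, \sum_(j | below c j i) b j = a i 0.
Proof.
move=> mem_N cconv a0 aasc; apply: exists_block_increments => // i j.
by case/andP => ij cij; apply: (aasc (c j)); rewrite ?mem_N.
Qed.

(** * Points of [X0] as indicator vectors of feasible sets *)

Lemma sum_mem_card (R : pzSemiRingType) (T : finType) (A S : {set T}) :
  \sum_(i in A) (i \in S)%:R = #|S :&: A|%:R :> R.
Proof.
rewrite -sum1_card natr_sum big_mkcond [RHS]big_mkcond/=.
by apply: eq_bigr => i _; rewrite inE; case: (i \in S); case: (i \in A).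
Qed.

Lemma X0_indicator (R : realType) (n t : nat) (f : R -> R) (a : 'cV[R]_n)
    (N : 'I_t -> {set 'I_n}) (w : R) (S : {set 'I_n}) :
  gub_feasible N S -> f (weight a S) <= w ->
  X0 f a N (w, \col_i (i \in S)%:R).
Proof.
move=> fS fw; split=> [i||k].
- by rewrite mxE; case: (i \in S); [right|left].
- rewrite mxE (_ : \sum_j _ = weight a S)// /weight [RHS]big_mkcond/=.
  by apply: eq_bigr => i _; rewrite !mxE; case: (i \in S); rewrite ?mulr1 ?mulr0.
- under eq_bigr do rewrite mxE.
  by rewrite sum_mem_card -[1]/(1%:R) ler_nat; have /forallP := fS; apply.
Qed.

Lemma X0_indicatorP (R : realType) (n t : nat) (f : R -> R) (a : 'cV[R]_n)
    (N : 'I_t -> {set 'I_n}) (w : R) (x : 'cV[R]_n) :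
  X0 f a N (w, x) ->
  exists S, [/\ gub_feasible N S, f (weight a S) <= w & x = \col_i (i \in S)%:R].
Proof.
move=> [x01 fw xN]; exists [set i | x i 0 == 1]%SET.
have xE : x = \col_i (i \in [set i | x i 0 == 1]%SET)%:R.
  apply/matrixP => i j; rewrite (ord1 j) mxE inE.
  by case: (x01 i) => ->; rewrite ?eqxx// eq_sym oner_eq0.
split=> //.
  apply/forallP => k; rewrite -(ler_nat R); have := xN k.
  by rewrite {1}xE; under eq_bigr do rewrite mxE; rewrite sum_mem_card.
move: fw; rewrite mxE (_ : \sum_j _ = weight a [set i | x i 0 == 1]%SET)//.
rewrite /weight [RHS]big_mkcond/=; apply: eq_bigr => i _.
rewrite {1}xE !mxE; case: (i \in _); rewrite ?mulr1 ?mulr0//.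
Qed.

(** * The two inclusions between the hull and the polyhedron *)

Theorem corollary5p4 (R : realType) (n t : nat) (f : R -> R) (a : 'cV[R]_n)
    (N : 'I_t -> {set 'I_n})
    (n_gt0 : (0 < n)%N) (t_gt0 : (0 < t)%N)
    (f_concave : concave_function f) (f0 : f 0 = 0)
    (a_ge0 : forall i, 0 <= a i 0)
    (N_part : consecutive_partition N)
    (a_asc : ascending_in_blocks a N) :
  conv_hull (X0 f a N) =
  [set p : R^o * 'cV[R]_n | let: (w, x) := p in
    [/\ forall delta : 'S_n, partial_ascending N delta ->
          \sum_(i < n) lifting_coef f a N delta (delta i) * x (delta i) 0 <= w,
        forall k : 'I_t, \sum_(i in N k) x i 0 <= 1
      & forall i : 'I_n, 0 <= x i 0 <= 1]].
Proof.
have [c mem_N cconv] := consecutive_partition_index N_part.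
have [b b0 sum_b] := exists_lifting_increments mem_N cconv a_ge0 a_asc.
have reindexE (delta : 'S_n) (F : 'I_n -> R) : \sum_i F (delta i) = \sum_i F i.
  by rewrite [RHS](reindex_perm delta).
apply/seteqP; split=> [|[w x] [xw xN x01]].
  (* It suffices that the polyhedron is convex and contains [X0]. *)
  apply: smallest_sub.
    move=> [w x] [w' x'] s; rewrite !inE /= => -[xw xN x01] [xw' xN' x01'].
    have s0 : 0 <= s%:num by [].
    have s1 : 0 <= 1 - s%:num by rewrite subr_ge0.
    split=> [delta PA|k|i].
    - rewrite (_ : \sum_(i < n) _ =
        s%:num * (\sum_(i < n) lifting_coef f a N delta (delta i) * x (delta i) 0) +
        (1 - s%:num) *
          (\sum_(i < n) lifting_coef f a N delta (delta i) * x' (delta i) 0)).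
        by apply: lerD; apply: ler_wpM2l => //; [exact: xw|exact: xw'].
      rewrite !mulr_sumr -big_split/=; apply: eq_bigr => i _.
      by rewrite !mxE /unstable.onem; ring.
    - under eq_bigr do rewrite !mxE; rewrite big_split/= -!mulr_sumr /unstable.onem.
      by have := ler_wpM2l s0 (xN k); have := ler_wpM2l s1 (xN' k); lra.
    - rewrite !mxE /unstable.onem; case/andP: (x01 i) => u1 v1.
      case/andP: (x01' i) => u2 v2.
      have := ler_wpM2l s0 u1; have := ler_wpM2l s1 u2.
      by have := ler_wpM2l s0 v1; have := ler_wpM2l s1 v2; lra.
  move=> [w x] /[dup] Xwx [x01 _ xN]; split=> // [delta PA|i]; last first.
    by case: (x01 i) => ->; rewrite ?lexx ler01.
  have [S [fS fw xE]] := X0_indicatorP Xwx.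
  apply: le_trans fw.
  rewrite (reindexE delta (fun i => lifting_coef f a N delta i * x i 0)).
  apply: le_trans (sum_lifting_coef_le mem_N PA f_concave f0 b0 sum_b fS).
  rewrite [leRHS]big_mkcond/= le_eqVlt; apply/orP; left; apply/eqP/eq_bigr => i _.
  by rewrite xE mxE; case: (i \in S); rewrite ?mulr1 ?mulr0.
(* For the converse, the point is written as a convex combination of points of [X0], hence lies in
   every convex [C] containing [X0]. *)
move=> C [cC XC].
have x0 i : 0 <= x i 0 by case/andP: (x01 i).
have [delta [l [PA l0] [l1 xE]]] := chain_decomposition mem_N x0 xN.
pose T (m : 'I_n.+1) := block_tops c (first_elems delta m).
have fT m : gub_feasible N (T m) := gub_feasible_block_tops mem_N _.
(* The slack in the inequality of [delta]. Every point of the combination is raised by this same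
   amount, which [X0] allows since it bounds [w] only from below. *)
pose d : R := (w : R) - \sum_i lifting_coef f a N delta i * x i 0.
have d0 : 0 <= d.
  by rewrite subr_ge0 -(reindexE delta (fun i => lifting_coef f a N delta i * x i 0)) xw.
(* Tightness at each [T m] makes the combination of the values of [f] equal to the left side of the
   inequality at [x]. *)
have wE : (w : R) = \sum_m l m * (f (weight a (T m)) + d).
  transitivity (\sum_i \sum_m lifting_coef f a N delta i * (l m * (i \in T m)%:R)
      + \sum_m l m * d).
    rewrite -mulr_suml l1 mul1r.
    under eq_bigr do rewrite -mulr_sumr -xE.
    by rewrite addrC subrK.
  rewrite exchange_big -big_split/=; apply: eq_bigr => m _.
  rewrite [RHS]mulrDr; congr (_ + _).
  rewrite -(sum_lifting_coef_block_tops mem_N PA f_concave f0 b0 sum_b) -1?ltnS//.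
  rewrite mulr_sumr [RHS]big_mkcond/=; apply: eq_bigr => i _.
  by case: (i \in _); rewrite ?mulr1 ?mulr0// mulrC.
pose p m : R^o * 'cV[R]_n := (f (weight a (T m)) + d, \col_i (i \in T m)%:R).
have -> : (w, x) = \sum_m l m *: p m.
  rewrite [RHS]surjective_pairing (big_morph fst (id1 := 0) (op1 := +%R))//.
  rewrite (big_morph snd (id1 := 0) (op1 := +%R))//; congr pair; first exact: wE.
  apply/matrixP => i j; rewrite (ord1 j) xE summxE.
  by apply: eq_bigr => m _; rewrite /p /= !mxE.
apply: convex_set_sum => // m; apply: XC; apply: X0_indicator => //.
by rewrite lerDl.
Qed.
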